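(* Let $w_\infty$ be an Arnoux-Rauzy word such that for all $(a,b,c)\in\mathbb{Z}^3$ there exist factors $u,v\in\mathcal{F}(w_\infty)$ with $\mathrm{ab}(u)-\mathrm{ab}(v)=(a,b,c)$. Then the imbalance of $w_\infty$ is infinite: $\mathrm{imb}(w_\infty)=\infty$.
   Context: Let $A=\{1,2,3\}$, let $A^*$ be the set of finite words over $A$ and $A^{\mathbb{N}}$ the set of infinite words ($\mathbb{N}=\{0,1,2,\dots\}$). A finite word $u=u[0]\cdots u[n-1]$ is a factor (of length $n$) of a (finite or infinite) word $w$ if there is $i\ge 0$ with $w[i+k]=u[k]$ for all $0\le k\le n-1$. $\mathcal{F}_n(w)$ denotes the set of factors of $w$ of length $n$ and $\mathcal{F}(w)$ the set of factors of all lengths. For a finite word $u$, $\mathrm{ab}(u)=(|u|_1,|u|_2,|u|_3)\in\mathbb{Z}^3$, where $|u|_\alpha$ is the number of occurrences of $\alpha$ in $u$. The imbalance of an infinite word $w$ is $\mathrm{imb}(w)=\sup_{n\in\mathbb{N}}\ \sup_{u,v\in\mathcal{F}_n(w)}\|\mathrm{ab}(u)-\mathrm{ab}(v)\|_\infty\in[0,\infty]$. Arnoux-Rauzy words. For $i\in A$ the Arnoux-Rauzy substitution $\sigma_i: A\to A^*$ is $\sigma_i(i)=i$, $\sigma_i(j)=ij$ for $j\in A\setminus\{i\}$, extended to a morphism for concatenation on $A^*$ and on $A^{\mathbb{N}}$. A sequence of finite words $(u_n)$ converges to an infinite word $w$ if for every sequence $(v_n)$ of infinite words, $u_n\cdot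 v_n$ converges to $w$ for the distance $\delta(x,y)=2^{-\min\{n: x[n]\ne y[n]\}}$ (and $\delta(x,x)=0$). If $(s_n)_{n\in\mathbb{N}}\in\{\sigma_1,\sigma_2,\sigma_3\}^{\mathbb{N}}$ contains infinitely many occurrences of each of $\sigma_1,\sigma_2,\sigma_3$, then for $\alpha\in A$ the sequence of finite words $s_0\circ\cdots\circ s_{n-1}(\alpha)$ converges to an infinite word $w_0$ not depending on $\alpha$; the words $w_0$ so obtained are the standard Arnoux-Rauzy words. An infinite word over $A$ is an Arnoux-Rauzy word if it has the same set of factors as some standard Arnoux-Rauzy word. *)

(* Defs.v *)
From mathcomp Require Import all_boot all_order all_algebra.
From mathcomp Require Import all_classical all_reals all_analysis.
Set Implicit Arguments.
Unset Strict Implicit.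
Unset Printing Implicit Defensive.
Import Order.TTheory GRing.Theory Num.Theory.
Import numFieldNormedType.Exports.
Local Open Scope classical_set_scope.
Local Open Scope ring_scope.

(* The letters 1, 2, 3 are represented by the ordinals 0, 1, 2. *)
Definition letter := 'I_3.
Definition word := seq letter.
Definition infword := nat -> letter.

Definition factors (w : infword) : set word :=
  [set u | exists i : nat,
     forall k : nat, (k < size u)%N -> w (i + k)%N = nth ord0 u k].

Definition factors_of_length (n : nat) (w : infword) : set word :=
  [set u | factors w u /\ size u = n].

Definition ab (u : word) : 'rV[int]_3 := \row_(i < 3) (count_mem i u)%:Z.

(* The norm of an integer matrix is the maximum of the absolute values of its
   entries, so the quantity below is the sup norm of ab u - ab v. *)
Definition imb (R : realType) (w : infword) : \bar R :=
  ereal_sup [set ereal_sup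
    [set ((`|ab p.1 - ab p.2|)%:~R : R)%:E
      | p in factors_of_length n w `*` factors_of_length n w] | n in [set: nat]].

Definition AR_letter (i j : letter) : word :=
  if j == i then [:: i] else [:: i; j].

Definition AR_subst (i : letter) (u : word) : word :=
  flatten (map (AR_letter i) u).

(* AR_comp s n u = (sigma_{s 0} \o ... \o sigma_{s (n - 1)}) u: the last
   substitution of the prefix is applied first. *)
Definition AR_comp (s : nat -> letter) (n : nat) (u : word) : word :=
  foldr AR_subst u (mkseq s n).

Definition cat_inf (u : word) (v : infword) : infword :=
  fun k => if (k < size u)%N then nth ord0 u k else v (k - size u)%N.

Definition word_dist (R : realType) (x y : infword) : R :=
  if pselect (exists n, x n != y n) is left h then 2%:R ^- ex_minn h else 0.

Definition word_cvg (R : realType) (u : nat -> word) (w : infword) : Prop :=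
  forall v : nat -> infword,
    (fun n => word_dist R (cat_inf (u n) (v n)) w) @ \oo --> (0 : R).

Definition standard_AR (R : realType) (w : infword) : Prop :=
  exists s : nat -> letter,
    (forall (i : letter) (N : nat), exists2 n, (N <= n)%N & s n = i) /\
    (forall a : letter, word_cvg R (fun n => AR_comp s n [:: a]) w).

Definition AR (R : realType) (w : infword) : Prop :=
  exists w0 : infword, standard_AR R w0 /\ factors w = factors w0.

(* Main.v *)
(* Any two factors whose abelianizations differ by a vector of coordinate sum
   zero have the same length; the vectors [(N, -N, 0)] are of this kind, and their
   norms are unbounded. *)
Require Import Defs.
From mathcomp Require Import all_boot all_order all_algebra.
From mathcomp Require Import all_classical all_reals all_analysis.
Import Order.TTheory GRing.Theory Num.Theory.
Local Open Scope ring_scope.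

(** Since the entries of [ab u] add up to the length ([sum_ab]), realizing (N, -N, 0) as a
    difference forces two factors of equal length, which the imbalance compares. Their distance is
    at least N ([ler_mx_norm_entry]), and N is arbitrary. *)

Lemma sum_ab (u : word) : \sum_i ab u 0 i = (size u)%:Z.
Proof.
under eq_bigr do rewrite mxE.
rewrite -(big_morph Posz PoszD (erefl : 0%N%:Z = 0)); congr Posz.
elim: u => [|x u IHu] /=; first by rewrite big1.
(* The head letter [x] contributes 1 to coordinate [x] and 0 to the others. *)
rewrite big_split /= IHu (bigD1 x)//= eqxx big1 ?addn0// => i /negPf.
by rewrite eq_sym => ->.
Qed.

Lemma ler_mx_norm_entry (K : realDomainType) (m n : nat) (A : 'M[K]_(m.+1, n.+1))
  i j : `|A i j| <= `|A|.
Proof.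
rewrite -[leRHS]/(mx_norm A) mx_normrE.
exact: (le_bigmax _ (fun ij => `|A ij.1 ij.2|) (i, j)).
Qed.

Theorem corollary1 (R : realType) (w : infword)
  (w_AR : AR R w)
  (w_ab : forall z : 'rV[int]_3, exists u v : word,
     [/\ factors w u, factors w v & ab u - ab v = z]) :
  imb R w = +oo%E.
Proof.
apply/eqyP => r r_gt0.
pose N := Num.bound r.
pose z : 'rV[int]_3 := \row_i nth 0 [:: N%:Z; - N%:Z; 0] i.
have [u [v [wu wv uvz]]] := w_ab z.
have size_uv : size v = size u.
  have : \sum_i (ab u - ab v) 0 i = 0.
    by rewrite uvz !big_ord_recl big_ord0 !mxE /= !addr0 subrr.
  have abB i : (ab u - ab v) 0 i = ab u 0 i - ab v 0 i by rewrite !mxE.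
  under eq_bigr do rewrite abB.
  by move/eqP; rewrite sumrB !sum_ab subr_eq0 => /eqP[->].
(* The norm of [z] is bounded by the inner supremum at length [size u], hence by the imbalance; it
   remains to see that it is at least [r]. *)
apply: (@le_trans _ _ (`|z|%:~R : R)%:E); last first.
  apply: (@le_trans _ _ (ereal_sup
    [set ((`|ab p.1 - ab p.2|)%:~R : R)%:E
      | p in factors_of_length (size u) w `*` factors_of_length (size u) w])).
    by apply: ereal_sup_ubound; exists (u, v) => //=; rewrite uvz.
  by apply: ereal_sup_ubound; exists (size u).
rewrite lee_fin (le_trans (ltW (archi_boundP (ltW r_gt0))))//.
(* Reading [N] as the image of an integer reduces the bound to integers, where entry 0 of [z]
   suffices. *)
rewrite -[leLHS]/((N%:Z)%:~R) ler_int.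
by have := ler_mx_norm_entry _ _ _ z 0 0; rewrite mxE.
Qed.
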